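(* Let $S$ be a monoid. A right $S$-act $Q$ is InC-injective if and only if $Q^{\theta}$ is an injective right $S$-act.
   Context: $S$ is a monoid with identity $1$. A right $S$-act (or simply act) is a non-empty set $A$ with a unitary right action of $S$, i.e. $(as)t=a(st)$ and $a1=a$. Subacts are non-empty subsets closed under the action; homomorphisms are maps commuting with the action. A zero element of an act is an element $\theta$ with $\theta s=\theta$ for all $s\in S$; $\Theta$ denotes the one-element act. For an act $A$, $A^{\theta}$ denotes $A$ itself if $A$ contains a zero element, and the disjoint union $A\sqcup\Theta$ otherwise. An act is decomposable if it is the union of two disjoint (non-empty) subacts, and indecomposable otherwise. An act $Q$ is injective if for every act $B$, every subact $C\subseteq B$ and every homomorphism $f:C\to Q$ there is a homomorphism $\overline f:B\to Q$ with $\overline f|_C=f$. An act $Q$ is InC-injective (indecomposable codomain injective) if this extension property holds for every indecomposable act $B$, every subact $C\subseteq B$ and every homomorphism $f:C\to Q$. *)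

(* Defs.v *)
From HB Require Import structures.
From mathcomp Require Import all_boot.
From mathcomp Require Import boolp classical_sets.

Set Implicit Arguments.
Unset Strict Implicit.
Unset Printing Implicit Defensive.

Local Open Scope classical_set_scope.
Local Open Scope group_scope.

Record right_act (S : monoidType) := RightAct {
  act_sort :> Type;
  actr : act_sort -> S -> act_sort;
  act_nonempty : inhabited act_sort;
  actr1 : forall a, actr a 1 = a;
  actrM : forall a s t, actr (actr a s) t = actr a (s * t)
}.

Section Acts.
Variable S : monoidType.
Implicit Types A B Q : right_act S.

(* S as a right act over itself; it places the monoid's universe below the
   universe over which the acts range. *)
Definition regular_act : right_act S :=
  @RightAct S S (fun a s => a * s) (inhabits 1) (@mulg1 S)
    (fun a s t => esym (mulgA a s t)).

Definition act_hom A B (f : A -> B) : Prop :=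
  forall a s, f (actr a s) = actr (f a) s.

Record subact A := Subact {
  subact_set :> set A;
  subact_nonempty : subact_set !=set0;
  subact_closed : forall a s, subact_set a -> subact_set (actr a s)
}.

Section SubactAct.
Variables (A : right_act S) (C : subact A).

Definition subact_actr (c : C) (s : S) : C :=
  exist _ (actr (val c) s) (mem_set (subact_closed s (set_mem (valP c)))).

Lemma subact_inhabited : inhabited C.
Proof. by case: (subact_nonempty C) => x Cx; exists; exists x; exact: mem_set. Qed.

Lemma subact_actr1 c : subact_actr c 1 = c.
Proof. by apply: val_inj; exact: actr1. Qed.

Lemma subact_actrM c s t :
  subact_actr (subact_actr c s) t = subact_actr c (s * t).
Proof. by apply: val_inj; exact: actrM. Qed.

Definition subact_act : right_act S :=
  RightAct subact_inhabited subact_actr1 subact_actrM.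

End SubactAct.

Definition is_zero A (z : A) : Prop := forall s, actr z s = z.

Definition has_zero A : Prop := exists z : A, is_zero z.

Definition one_act : right_act S :=
  @RightAct S unit (fun _ _ => tt) (inhabits tt)
    (fun a => let: tt := a in erefl) (fun _ _ _ => erefl).

Section SumAct.
Variables A B : right_act S.

Definition sum_actr (x : A + B) (s : S) : A + B :=
  match x with inl a => inl (actr a s) | inr b => inr (actr b s) end.

Lemma sum_inhabited : inhabited (A + B).
Proof. by case: (act_nonempty A) => a; exists; left. Qed.

Lemma sum_actr1 x : sum_actr x 1 = x.
Proof. by case: x => x /=; rewrite actr1. Qed.

Lemma sum_actrM x s t : sum_actr (sum_actr x s) t = sum_actr x (s * t).
Proof. by case: x => x /=; rewrite actrM. Qed.

Definition sum_act : right_act S := RightAct sum_inhabited sum_actr1 sum_actrM.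

End SumAct.

Definition act_theta A : right_act S :=
  if pselect (has_zero A) then A else sum_act A one_act.

Definition decomposable A : Prop :=
  exists C D : subact A, C `|` D = [set: A] /\ C `&` D = set0.

Definition indecomposable A : Prop := ~ decomposable A.

Definition extends_from Q B : Prop :=
  forall (C : subact B) (f : subact_act C -> Q), act_hom f ->
    exists g : B -> Q, act_hom g /\ forall c : C, g (val c) = f c.

Definition injective_act Q : Prop := forall B, extends_from Q B.

Definition InC_injective Q : Prop :=
  forall B, indecomposable B -> extends_from Q B.

End Acts.

(* Main.v *)
Require Import Defs.
From mathcomp Require Import all_boot.
From mathcomp Require Import boolp classical_sets.

(** An act is the disjoint union of its connected components, a component being
    a class of the equivalence relation generated by [a ~ a s]; components are
    exactly the maximal indecomposable subacts.  Extension problems can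
    therefore be solved one component at a time and the solutions glued
    ([extension_glue]), and an InC-injective act solves the problem on every
    component that meets the domain ([InC_extension_component]).

    From left to right, let [f : C -> Q^theta] with [C] a subact of [B].
    Components of [B] that miss [C] are sent to the zero.  If [Q] has a zero,
    the other components are handled by InC-injectivity.  If [Q] has none, then
    [Q^theta] is [Q] plus an isolated zero, and the danger is a component on
    which [f] takes values both in [Q] and in [Theta]: no extension could exist
    there.  This never happens ([InC_separated]): collapsing to a point the part
    [D] of [C] that goes to [Theta] produces a zero connected to elements that
    still map to [Q], and extending over that component carries this zero to a
    zero of [Q].  So on each component [f] is either constant, or lands in [Q]
    and extends by InC-injectivity.

    From right to left, an extension [B -> Q^theta] of a map into [Q] cannot
    leave [Q] when [B] is indecomposable, since the preimages of [Q] and of the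
    isolated zero would decompose [B]. *)

Set Implicit Arguments.
Unset Strict Implicit.
Unset Printing Implicit Defensive.

Local Open Scope classical_set_scope.
Local Open Scope group_scope.

(** Lets a subact be applied to a point, as sets can be. *)
#[local] Identity Coercion fun_of_set : set >-> Funclass.

Section Theory.
Variable S : monoidType.
Implicit Types A B Q : right_act S.

(** * Partial homomorphisms *)

(** Partial homomorphisms are encoded as total functions constrained on a set
    only, so that restricting, composing and extending them involves no
    subtypes. *)
Definition hom_on A Q (C : set A) (f : A -> Q) : Prop :=
  forall a s, C a -> f (actr a s) = actr (f a) s.

Lemma extends_fromP Q B :
  extends_from Q B <->
  forall (C : subact B) (f : B -> Q), hom_on C f ->
    exists g : B -> Q, act_hom g /\ forall b, C b -> g b = f b.
Proof.
split=> [ext C f fhom|ext C f fhom].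
  have fChom : act_hom (fun c : subact_act C => f (val c)).
    by move=> c s; rewrite /= fhom //; exact: set_mem (valP c).
  have [g [ghom gf]] := ext C _ fChom.
  by exists g; split=> // b Cb; exact: (gf (exist _ b (mem_set Cb))).
have [q] := act_nonempty Q.
pose f' b := if pselect (C b) is left Cb then f (exist _ b (mem_set Cb)) else q.
have f'E (c : C) : f' (val c) = f c.
  rewrite /f'; case: pselect => [Cb|]; last by case; exact: set_mem (valP c).
  by congr f; exact: val_inj.
have f'hom : hom_on C f'.
  move=> b s Cb; pose c : C := exist _ b (mem_set Cb).
  rewrite (f'E c : f' b = f c) -fhom.
  exact: (f'E (subact_actr c s)).
have [g [ghom gf]] := ext C f' f'hom.
exists g; split=> // c; rewrite -f'E; apply: gf; exact: set_mem (valP c).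
Qed.

(** * Connected components *)

(** The equivalence relation generated by [x ~ x s], encoded by the sets that
    it saturates instead of by zigzags. *)
Definition connected A (a : A) : set A := [set b |
  forall P : set A, (forall x s, P x <-> P (actr x s)) -> P a -> P b].

Lemma connected_refl A (a : A) : connected a a.
Proof. by []. Qed.

Lemma connected_trans A (a b c : A) :
  connected a b -> connected b c -> connected a c.
Proof. by move=> ab bc P PS /(ab P PS) /(bc P PS). Qed.

Lemma connected_sym A (a b : A) : connected a b -> connected b a.
Proof.
move=> ab P PS Pb; apply: contrapT => nPa.
have nPS x s : (~` P) x <-> (~` P) (actr x s).
  by rewrite /setC /=; have := PS x s; tauto.
exact: (ab _ nPS nPa).
Qed.

Lemma connected_actr A (a : A) s : connected a (actr a s).
Proof. by move=> P PS /(PS a s). Qed.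

Arguments connected_refl {A} a.
Arguments connected_actr {A} a s.

Lemma connected_eq A (a b : A) : connected a b -> connected a = connected b.
Proof.
move=> ab; apply/seteqP; split=> c; apply: connected_trans => //.
exact: connected_sym.
Qed.

Lemma connected_hom A B (h : A -> B) a b :
  act_hom h -> connected a b -> connected (h a) (h b).
Proof.
move=> hhom ab P PS; apply: (ab (h @^-1` P)) => x s /=.
by rewrite /preimage /= hhom; exact: PS.
Qed.

Definition component A (a : A) : subact A :=
  @Subact _ A (connected a) (ex_intro _ a (connected_refl a))
    (fun b s ab => connected_trans ab (connected_actr b s)).

Lemma indecomposable_connected A (a b : A) :
  indecomposable A -> connected a b.
Proof.
move=> indA; apply: contrapT => nab; apply: indA.
have ncl x s : ~ connected a x -> ~ connected a (actr x s).
  move=> nax axs; apply: nax; apply: connected_trans axs _.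
  exact: connected_sym (connected_actr x s).
pose D := @Subact _ A (~` connected a) (ex_intro _ b nab) ncl.
by exists (component a), D; rewrite setUv setICr.
Qed.

(** If the component of [a] is the union of disjoint subacts [C] and [D], the
    set of points lying in [C] saturates the relation, so it contains the whole
    component as soon as it contains one point of it. *)
Lemma component_indecomposable A (a : A) :
  indecomposable (subact_act (component a)).
Proof.
case=> C [D [CUD CID]].
have [[c Cc] [d Dd]] := (subact_nonempty C, subact_nonempty D).
have nCD x : C x -> D x -> False.
  by move=> Cx Dx; have : (C `&` D) x by []; rewrite CID.
pose P := [set x : A | exists2 y : subact_act (component a), C y & val y = x].
have PS x s : P x <-> P (actr x s).
  split=> [[y Cy <-]|[y Cy yE]].
    by exists (actr y s) => //; exact: subact_closed.
  have ax : connected a x.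
    apply: connected_trans (set_mem (valP y)) _; rewrite yE.
    exact: connected_sym (connected_actr x s).
  pose z : subact_act (component a) := exist _ x (mem_set ax).
  have zsE : actr z s = y by apply: val_inj; rewrite yE.
  have : (C `|` D) z by rewrite CUD.
  case=> [Cz|Dz]; first by exists z.
  have : D (actr z s) := subact_closed s Dz.
  by rewrite zsE => /(nCD _ Cy).
have cd : connected (val c) (val d).
  apply: connected_trans (set_mem (valP d)).
  exact: connected_sym (set_mem (valP c)).
have [|y Cy /val_inj yd] := cd P PS; first by exists c.
by apply: (nCD y) => //; rewrite yd.
Qed.

(** * Extension by components *)

(** A hom on every component extending [f] there gives a global one; the local
    extensions are chosen per component, seen as a set, so that connected
    points use the same one. *)
Lemma extension_glue Q B (C : set B) (f : B -> Q) :
  (forall b, exists g, hom_on (connected b) g /\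
     forall x, connected b x -> C x -> g x = f x) ->
  exists g : B -> Q, act_hom g /\ forall x, C x -> g x = f x.
Proof.
move=> loc.
have locK (K : set B) : exists g : B -> Q, (exists b, K = connected b) ->
    hom_on K g /\ forall x, K x -> C x -> g x = f x.
  have [[b ->]|nK] := pselect (exists b, K = connected b).
    by have [g gP] := loc b; exists g.
  by exists f.
have [G GP] := choice locK.
exists (fun b => G (connected b) b); split=> [b s|b Cb].
  rewrite -(connected_eq (connected_actr b s)).
  by have [|+ _] := GP (connected b); [exists b|apply].
by have [|_] := GP (connected b); [exists b|apply].
Qed.

Lemma InC_extension_component Q B (C : subact B) (f : B -> Q) b c :
  InC_injective Q -> hom_on C f -> C c -> connected b c ->
  exists g, hom_on (connected b) g /\
    forall x, connected b x -> C x -> g x = f x.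
Proof.
move=> injQ fhom Cc bc; pose K := subact_act (component b).
pose inK x (bx : connected b x) : K := exist _ x (mem_set bx).
pose CK := @Subact _ K [set x : K | C (val x)]
  (ex_intro _ (inK c bc) Cc) (fun x s Cx => subact_closed s Cx).
have fKhom : hom_on CK (fun x : K => f (val x)).
  by move=> x s Cx /=; exact: fhom.
have [g [ghom gf]] :=
  (extends_fromP Q K).1 (injQ K (@component_indecomposable B b)) CK _ fKhom.
pose g' x := if pselect (connected b x) is left bx then g (inK x bx) else f x.
have g'E x (bx : connected b x) : g' x = g (inK x bx).
  by rewrite /g'; case: pselect => // bx'; congr g; exact: val_inj.
exists g'; split=> [x s bx|x bx Cx]; last by rewrite (g'E x bx) gf.
rewrite (g'E _ (connected_trans bx (connected_actr x s))) (g'E _ bx) -ghom.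
by congr g; exact: val_inj.
Qed.

(** * Collapsing a subact *)

(** The functions from [S] to [T] form the cofree act on the set [T]. *)
Definition cofree_act (T : Type) (t : T) : right_act S.
Proof.
refine (@RightAct S (S -> T) (fun x s u => x (s * u)) (inhabits (fun=> t)) _ _).
- by move=> x; apply/funext => u; rewrite mul1g.
- by move=> x s t'; apply/funext => u; rewrite mulgA.
Defined.

(** The Rees quotient of [A] by [D], up to enlarging the target: the collapse
    [A -> A] of [D] to a point [d] of [D] is a mere function, but it induces a
    homomorphism to the cofree act, and evaluation at [1] recovers the points
    outside [D]. *)
Lemma collapse_subact A (D : subact A) :
  exists (R : right_act S) (p : A -> R) (r : R -> A),
    [/\ act_hom p, forall a, D a -> is_zero (p a)
      & forall a, ~ D a -> r (p a) = a].
Proof.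
have [d Dd] := subact_nonempty D.
pose col a := if pselect (D a) then d else a.
exists (cofree_act d), (fun a u => col (actr a u)), (fun x => x 1).
split=> [a s|a Da s|a nDa].
- by apply/funext => u; rewrite /= actrM.
- apply/funext => u; rewrite /= /col.
  by do 2![case: pselect => [?|[]]; last exact: subact_closed].
- by rewrite /col actr1; case: pselect.
Qed.

(** After collapsing [D], the image of [c] is connected to a zero, which any
    extension of [f] over their component sends to a zero of [Q]. *)
Lemma InC_separated Q B (C D : subact B) (f : B -> Q) c d :
  InC_injective Q -> hom_on C f -> (forall x, C x -> ~ D x) ->
  C c -> D d -> connected c d -> has_zero Q.
Proof.
move=> injQ fhom CD Cc Dd cd.
have [R [p [r [phom pzero rp]]]] := collapse_subact D.
have pCcl x s : (p @` C) x -> (p @` C) (actr x s).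
  by move=> [b Cb <-]; exists (actr b s); [exact: subact_closed|exact: phom].
pose pC := @Subact _ R (p @` C)
  (ex_intro _ (p c) (ex_intro2 _ _ c Cc erefl)) pCcl.
have frhom : hom_on pC (f \o r).
  move=> _ s [b Cb <-] /=; rewrite -phom.
  rewrite !rp; [exact: fhom|exact: CD|].
  by apply: CD; exact: subact_closed.
have pCc : pC (p c) by exists c.
have [g [ghom _]] :=
  InC_extension_component injQ frhom pCc (connected_refl (p c)).
exists (g (p d)) => s; rewrite -ghom; last exact: connected_hom.
by rewrite pzero.
Qed.

(** * Adjoining a zero *)

Lemma InC_injective_has_zero Q :
  has_zero Q -> InC_injective Q -> injective_act Q.
Proof.
move=> [z z0] injQ B; apply/extends_fromP => C f fhom.
apply: extension_glue => b.
have [[c [bc Cc]]|nC] := pselect (exists c, connected b c /\ C c).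
  exact: InC_extension_component Cc bc.
exists (fun=> z); split=> [x s _|x bx Cx]; first by rewrite z0.
by case: nC; exists x.
Qed.

Lemma InC_injective_sum_one Q :
  ~ has_zero Q -> InC_injective Q -> injective_act (sum_act Q (one_act S)).
Proof.
move=> nz injQ B; apply/extends_fromP => C f fhom.
apply: extension_glue => b.
have [[c [bc Cc [q fc]]]|nQ] :=
    pselect (exists c, [/\ connected b c, C c & exists q, f c = inl q]);
  last first.
  exists (fun=> inr tt); split=> // x bx Cx.
  case fx: (f x) => [q|[]] //.
  by case: nQ; exists x; split=> //; exists q.
have CQcl x s : (C x /\ exists q, f x = inl q) ->
    C (actr x s) /\ exists q, f (actr x s) = inl q.
  move=> [Cx [q' fx]]; split; first exact: subact_closed.
  by exists (actr q' s); rewrite fhom // fx.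
pose CQ := @Subact _ B [set x | C x /\ exists q, f x = inl q]
  (ex_intro _ c (conj Cc (ex_intro _ q fc))) CQcl.
pose fQ x := if f x is inl q' then q' else q.
have fQhom : hom_on CQ fQ.
  by move=> x s [Cx [q' fx]]; rewrite /fQ fhom // fx.
have CQc : CQ c by split=> //; exists q.
have [g [ghom gf]] := InC_extension_component injQ fQhom CQc bc.
exists (inl \o g); split=> [x s bx|x bx Cx] /=; first by rewrite ghom.
case fx: (f x) => [q'|[]].
  by rewrite gf //; [rewrite /fQ fx|split=> //; exists q'].
have CTcl y s : (C y /\ f y = inr tt) -> C (actr y s) /\ f (actr y s) = inr tt.
  by move=> [Cy fy]; split; [exact: subact_closed|rewrite fhom // fy].
pose CT := @Subact _ B [set y | C y /\ f y = inr tt]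
  (ex_intro _ x (conj Cx fx)) CTcl.
case: nz; apply: (@InC_separated Q B CQ CT fQ c x) => //.
  by move=> y [_ [q' fy]] [_]; rewrite fy.
exact: connected_trans (connected_sym bc) bx.
Qed.

Lemma injective_sum_one_InC Q :
  injective_act (sum_act Q (one_act S)) -> InC_injective Q.
Proof.
move=> injT B indB; apply/extends_fromP => C f fhom.
have [c Cc] := subact_nonempty C.
pose T := sum_act Q (one_act S).
have infhom : hom_on C (fun x => inl (f x) : T).
  by move=> x s Cx; rewrite fhom.
have [g [ghom gf]] := (extends_fromP T B).1 (injT B) C _ infhom.
have gQ x : exists q, g x = inl q.
  pose P := [set y | exists q, g y = inl q].
  have PS y s : P y <-> P (actr y s).
    rewrite /P /= ghom; case: (g y) => [q|u] /=; last by split=> -[].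
    by split=> _; [exists (actr q s)|exists q].
  have Pc : P c by exists (f c); exact: gf.
  have cx : connected c x := indecomposable_connected _ indB.
  exact: cx PS Pc.
have [h hE] := choice gQ.
have inlI : injective (@inl Q (one_act S)) by move=> ? ? [].
exists h; split=> [x s|x Cx]; apply: inlI; last by rewrite -hE gf.
by rewrite -hE ghom hE.
Qed.

End Theory.

Theorem theorem2p6 (S : monoidType) (Q : right_act S) :
  InC_injective Q <-> injective_act (act_theta Q).
Proof.
rewrite /act_theta; case: pselect => [hz|nz]; split.
- exact: InC_injective_has_zero.
- by move=> injQ B _; exact: injQ.
- exact: InC_injective_sum_one.
- exact: injective_sum_one_InC.
Qed.
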